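(* Let $\mathbb{F}_q$ be a finite field of odd characteristic and let $n \geq 1$. Then $$|\operatorname{Gr}_{1,n}^{\geq 0}(\mathbb{F}_q)| = \sum_{i=0}^{n-1} \left(\frac{q+1}{2}\right)^i = \sum_{i=0}^{n-1} \sum_{j=i}^{n-1} \frac{\binom{j}{i}}{2^j} q^i = \frac{\left(\frac{q+1}{2}\right)^n - 1}{\left(\frac{q+1}{2}\right) - 1}$$ and $$|\operatorname{Gr}_{1,n}^{>0}(\mathbb{F}_q)| = \left(\frac{q-1}{2}\right)^{n-1} = 2^{-(n-1)} \sum_{i=0}^{n-1} (-1)^{n-1-i} \binom{n-1}{i} q^i.$$
   Context: $\mathbb{F}_q$ is the finite field with $q$ elements. For $a \in \mathbb{F}_q$, write $a \geq 0$ if $a = x^2$ for some $x \in \mathbb{F}_q$, and $a > 0$ if $a \geq 0$ and $a \neq 0$. $\operatorname{Gr}_{k,n}(\mathbb{F}_q)$ is the set of $k$-dimensional subspaces of $\mathbb{F}_q^n$. For a full rank $k \times n$ matrix $A$, $[A]$ denotes its row span, and for a $k$-element subset $I$ of $[n]=\{1,\dots,n\}$, $\Delta_I(A)$ is the $k \times k$ minor of $A$ using the columns indexed by $I$ (in increasing order; for $k=1$ these are just the entries of the row vector $A$). The totally nonnegative and totally positive finite Grassmannians are $$\operatorname{Gr}_{k,n}^{\geq 0}(\mathbb{F}_q) = \{V \in \operatorname{Gr}_{k,n}(\mathbb{F}_q) : \text{there is a matrix } A \text{ with } [A] = V \text{ and } \Delta_I(A) \geq 0 \text{ for all } k\text{-element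 } I \subseteq [n]\},$$ $$\operatorname{Gr}_{k,n}^{> 0}(\mathbb{F}_q) = \{V \in \operatorname{Gr}_{k,n}(\mathbb{F}_q) : \text{there is a matrix } A \text{ with } [A] = V \text{ and } \Delta_I(A) > 0 \text{ for all } k\text{-element } I \subseteq [n]\}.$$ The equalities of the formulas are equalities of rational numbers. *)

(* Defs.v *)
From HB Require Import structures.
From mathcomp Require Import all_boot all_order all_algebra.

Set Implicit Arguments.
Unset Strict Implicit.
Unset Printing Implicit Defensive.

Import Order.TTheory GRing.Theory Num.Theory.
Local Open Scope ring_scope.

(* The subtype structure of {vspace vT} is hidden in [VectorInternalTheory]. *)
Import VectorInternalTheory.
HB.instance Definition _ (F : finFieldType) (vT : vectType F) :=
  [Countable of {vspace vT} by <:].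
HB.instance Definition _ (F : finFieldType) (vT : vectType F) :=
  [Finite of {vspace vT} by <:].

Definition ge0 (F : finFieldType) (a : F) : bool := [exists x : F, a == x ^+ 2].
Definition gt0 (F : finFieldType) (a : F) : bool := ge0 a && (a != 0).

Definition ksubset (k n : nat) := {I : {set 'I_n} | #|I| == k}.

(* [enum_val] lists the elements of a subset of ['I_n] in increasing order. *)
Definition ksubset_nth (k n : nat) (I : ksubset k n) (j : 'I_k) : 'I_n :=
  enum_val (cast_ord (esym (eqP (valP I))) j).

Definition minor (F : finFieldType) (k n : nat) (I : ksubset k n)
    (A : 'M[F]_(k, n)) : F :=
  \det (colsub (ksubset_nth I) A).

Definition row_span (F : finFieldType) (k n : nat) (A : 'M[F]_(k, n)) :
    {vspace 'rV[F]_n} :=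
  <<[seq row i A | i : 'I_k]>>%VS.

Definition Gr (F : finFieldType) (k n : nat) : {set {vspace 'rV[F]_n}} :=
  [set V | \dim V == k].

(* A k x n matrix whose row span has dimension k automatically has full rank. *)
Definition Gr_ge0 (F : finFieldType) (k n : nat) : {set {vspace 'rV[F]_n}} :=
  [set V in Gr F k n | [exists A : 'M[F]_(k, n),
    (row_span A == V) && [forall I : ksubset k n, ge0 (minor I A)]]].

Definition Gr_gt0 (F : finFieldType) (k n : nat) : {set {vspace 'rV[F]_n}} :=
  [set V in Gr F k n | [exists A : 'M[F]_(k, n),
    (row_span A == V) && [forall I : ksubset k n, gt0 (minor I A)]]].

(* Main.v *)
Require Import Defs.
From mathcomp Require Import all_boot all_order all_algebra.
From mathcomp Require Import ring.

Import Order.TTheory GRing.Theory Num.Theory.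
Local Open Scope ring_scope.

(** A point of [Gr F 1 n] is a line of [F^n], and the [1 x 1] minors of a row
    vector are its entries; so the lines to be counted are those spanned by a
    nonzero vector whose entries are all squares (resp. all nonzero squares).
    Call such a vector good.  The nonzero squares form a subgroup of index 2
    of the multiplicative group [F^*], hence there are [m = (q - 1) / 2] of
    them, and [m + 1 = (q + 1) / 2] squares counting zero.

    The key observation is that a good vector [v] has some nonzero square
    entry, so that a scalar multiple [c *: v] is good exactly when [c] is itself
    a nonzero square.  Every line that contains a good vector therefore contains
    exactly [m] of them ([card_lines]), and the number of lines is the number
    of good vectors divided by [m].  There are [(m + 1) ^ n - 1] good vectors
    in the nonnegative case and [m ^ n] in the positive case, which gives the
    closed forms [((m + 1) ^ n - 1) / m] and [m ^ (n - 1)].  The remaining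
    expressions follow by summing the geometric series and by the binomial
    theorem. *)

(** * Squares in a finite field *)

Section Squares.

Variable F : finFieldType.
Implicit Types a b x : F.

Lemma ge0P a : reflect (exists x, a = x ^+ 2) (ge0 a).
Proof.
by apply: (iffP existsP) => -[x] => [/eqP -> | ->]; exists x.
Qed.

Lemma ge0_0 : ge0 (0 : F).
Proof. by apply/ge0P; exists 0; rewrite expr0n. Qed.

Lemma gt0_neq0 a : gt0 a -> a != 0.
Proof. by case/andP. Qed.

(** If [c * a] and [a] are squares, [c] is the square of the quotient of
    their roots. *)
Lemma ge0_mulr a c : gt0 a -> ge0 (c * a) = ge0 c.
Proof.
case/andP=> /ge0P[x ->]; rewrite expf_eq0 /= => x0.
apply/ge0P/ge0P => -[y Dy]; last by exists (y * x); rewrite Dy exprMn.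
by exists (y / x); rewrite expr_div_n -Dy mulfK // expf_eq0.
Qed.

Lemma gt0_mulr a c : gt0 a -> gt0 (c * a) = gt0 c.
Proof.
by move=> a0; rewrite /gt0 ge0_mulr // mulf_eq0 negb_or (gt0_neq0 _ a0) andbT.
Qed.

Lemma card_ge0 : #|@ge0 F| = #|@gt0 F|.+1.
Proof.
rewrite (cardD1 0) [0 \in _]ge0_0 add1n; congr _.+1.
by apply: eq_card => a; rewrite !inE andbC.
Qed.

(** Squaring maps [F^*] onto the nonzero squares, and its fibres [{x, -x}]
    have two elements because [2] is invertible. *)
Lemma double_card_gt0 : (2 : F) != 0 -> (2 * #|@gt0 F|).+1 = #|F|.
Proof.
move=> two0; rewrite [RHS](cardD1 (0 : F)) inE add1n; congr _.+1.
transitivity (\sum_(x : F | x != 0%R) 1)%N; last first.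
  by rewrite sum1_card; apply: eq_card => x; rewrite !inE andbT.
rewrite (partition_big (fun x => x ^+ 2) (@gt0 F)); last first.
  by move=> x x0; rewrite /gt0 expf_eq0 x0 andbT; apply/ge0P; exists x.
rewrite mulnC -sum_nat_const; apply: eq_bigr => a /andP[/ge0P[x ->]].
rewrite expf_eq0 /= => x0.
have xNx : x != - x.
  by rewrite -subr_eq0 opprK -mulr2n -mulr_natl mulf_neq0.
rewrite sum1_card; transitivity #|[set x; - x]|; first by rewrite cards2 xNx.
apply: eq_card => y; rewrite !inE [RHS]unfold_in eqf_sqr.
by symmetry; apply: andb_idl => /orP[] /eqP ->; rewrite ?oppr_eq0.
Qed.

End Squares.

(** * Lines spanned by good vectors *)

Section Lines.

Variables (F : finFieldType) (n : nat).
Implicit Types (v : 'rV[F]_n) (P : pred 'rV[F]_n).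

Lemma row_span1 v : row_span v = <[v]>%VS.
Proof.
apply/eqP; rewrite eqEsubv; apply/andP; split.
  apply/span_subvP => _ /imageP[i _ ->].
  by rewrite ord1 row_id memv_line.
rewrite -memvE; apply/memv_span/imageP; exists 0 => //.
by rewrite row_id.
Qed.

(** Applied to [v = 0] and [c = 0], the hypothesis forces [P] to exclude zero;
    hence each line meeting [P] meets it in a bijective image of the set of
    nonzero squares, and counting [P] line by line gives the identity. *)
Lemma card_lines P :
    (forall v c, P v -> P (c *: v) = gt0 c) ->
  (#|[set <[v]>%VS | v : 'rV[F]_n in P]| * #|@gt0 F| = #|P|)%N.
Proof.
move=> PZ; rewrite -[RHS]sum1_card.
rewrite (partition_big (fun v : 'rV[F]_n => <[v]>%VS)
           (fun V => V \in [set <[v]>%VS | v : 'rV[F]_n in P])); last first.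
  by move=> v Pv; apply: imset_f.
rewrite -sum_nat_const; apply: eq_bigr => _ /imsetP[v Pv ->].
have v0 : v != 0.
  apply: contraTneq Pv => ->; apply/negP => P0.
  by have := PZ 0 0 P0; rewrite scaler0 [P 0]P0 /gt0 eqxx andbF.
rewrite sum1_card -(card_image (f := fun c : F => c *: v)); last first.
  move=> c d /eqP; rewrite -subr_eq0 -scalerBl scaler_eq0 (negPf v0) orbF.
  by rewrite subr_eq0 => /eqP.
apply: eq_card => w; apply/imageP/idP => [[c c0 ->]|].
  apply/andP; split; first by rewrite [_ \in _]PZ.
  apply/eqP/vspaceP => u; apply/vlineP/vlineP => -[k ->].
    by exists (k * c); rewrite scalerA.
  by exists (k / c); rewrite scalerA divfK // gt0_neq0.
case/andP=> Pw /eqP Dw.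
have /vlineP[c Dc] : w \in <[v]>%VS by rewrite -Dw memv_line.
by exists c => //; rewrite Dc in Pw; rewrite -[_ \in _]/(gt0 c) -(PZ v).
Qed.

Lemma card_rV_entries (S : pred F) :
  #|[pred v : 'rV[F]_n | [forall j, S (v 0 j)]]| = (#|S| ^ n)%N.
Proof.
rewrite -[X in (_ ^ X)%N](card_ord n) -card_ffun_on.
pose f v := [ffun j => v 0 j].
have f_inj : injective f.
  by move=> v w /ffunP fvw; apply/rowP => j; have := fvw j; rewrite !ffunE.
rewrite -(card_image f_inj); apply: eq_card => g.
apply/imageP/ffun_onP => [[v /forallP Sv ->] j | Sg].
  by rewrite ffunE; apply: Sv.
exists (\row_j g j); last by apply/ffunP => j; rewrite ffunE mxE.
by apply/forallP => j; rewrite mxE; apply: Sg.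
Qed.

(** The minor indexed by the singleton [{j}] is the entry in column [j]. *)
Lemma forall_minor1 (S : pred F) v :
  [forall I : ksubset 1 n, S (minor I v)] = [forall j, S (v 0 j)].
Proof.
apply/forallP/forallP => Sv j; last by rewrite /minor det_mx11 mxE; apply: Sv.
pose I : ksubset 1 n := exist _ [set j] (introT eqP (cards1 j)).
have := Sv I; rewrite /minor det_mx11 mxE /ksubset_nth.
have := enum_valP (cast_ord (esym (eqP (valP I))) 0).
by rewrite inE => /eqP ->.
Qed.

Lemma Gr1_imset (S : pred F) :
  [set V in Gr F 1 n | [exists A : 'M[F]_(1, n),
     (row_span A == V) && [forall I : ksubset 1 n, S (minor I A)]]]
  = [set <[v]>%VS | v : 'rV[F]_n in [pred v : 'rV[F]_n |
       (v != 0) && [forall j, S (v 0 j)]]].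
Proof.
apply/setP => V; rewrite !inE; apply/andP/imsetP.
  case=> dV /existsP[v /andP[/eqP DV]]; rewrite forall_minor1 => Sv.
  rewrite row_span1 in DV; exists v; last by [].
  by move: dV; rewrite -DV dim_vline inE Sv andbT; case: (v == 0).
case=> v /andP[v0 Sv] ->; split; first by rewrite dim_vline v0.
by apply/existsP; exists v; rewrite row_span1 eqxx forall_minor1.
Qed.

(** Multiplying by a square keeps square entries square; conversely, any
    nonzero entry of the vector detects whether the factor is a square.  The zero
    vector spans no line, which is where the predecessor comes from. *)
Lemma card_Gr1_ge0 :
  (#|Gr_ge0 F 1 n| * #|@gt0 F| = (#|@ge0 F| ^ n).-1)%N.
Proof.
rewrite /Gr_ge0 (Gr1_imset (@ge0 F)) card_lines; last first.
  move=> v c /andP[v0 /forallP Sv].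
  have /rV0Pn[j vj0] := v0.
  have vj : gt0 (v 0 j) by rewrite /gt0 Sv.
  apply/andP/idP => [[cv0 /forallP /(_ j)] | c0].
    rewrite mxE ge0_mulr // /gt0 => ->.
    by apply: contraNneq cv0 => ->; rewrite scale0r.
  rewrite scaler_eq0 (negPf v0) (negPf (gt0_neq0 _ _ c0)); split=> //.
  apply/forallP => k; rewrite mxE mulrC.
  have [->|vk0] := eqVneq (v 0 k) 0; first by rewrite mul0r ge0_0.
  by rewrite ge0_mulr.
rewrite -card_rV_entries [in RHS](cardD1 0) inE /=.
have -> : [forall j, ge0 ((0 : 'rV[F]_n) 0 j)].
  by apply/forallP => j; rewrite mxE ge0_0.
by apply: eq_card => v; rewrite !inE.
Qed.

(** Zero is not positive, so a vector with at least one entry and only positive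
    ones is nonzero: all [#|gt0| ^ n] of them span lines. *)
Lemma card_Gr1_gt0 :
  (0 < n)%N -> (#|Gr_gt0 F 1 n| * #|@gt0 F| = #|@gt0 F| ^ n)%N.
Proof.
move=> n0; pose j0 := Ordinal n0.
rewrite /Gr_gt0 (Gr1_imset (@gt0 F)) card_lines; last first.
  move=> v c /andP[v0 /forallP Sv].
  apply/andP/idP => [[_ /forallP /(_ j0)] | c0]; first by rewrite mxE gt0_mulr.
  rewrite scaler_eq0 (negPf v0) (negPf (gt0_neq0 _ _ c0)); split=> //.
  by apply/forallP => k; rewrite mxE gt0_mulr.
rewrite -card_rV_entries; apply: eq_card => v; rewrite !inE andbC.
case: forallP => //= /(_ j0) vj; apply: contraTneq vj => ->.
by rewrite mxE /gt0 eqxx andbF.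
Qed.

End Lines.

(** * Summation formulas *)

(** Since ['C(j, i)] vanishes for [j < i], the triangular sum is the
    rectangular one, whose other order of summation has inner sum
    [((x + 1) / 2) ^+ j] by the binomial theorem. *)
Lemma sum_half_powers (K : fieldType) (x : K) n :
  \sum_(0 <= i < n) ((x + 1) / 2) ^+ i
  = \sum_(0 <= i < n) \sum_(i <= j < n) ('C(j, i)%:R / 2 ^+ j) * x ^+ i.
Proof.
transitivity
  (\sum_(0 <= i < n) \sum_(0 <= j < n) ('C(j, i)%:R / 2 ^+ j) * x ^+ i).
  rewrite exchange_big; apply: eq_big_nat => j /= ltjn.
  rewrite expr_div_n addrC exprDn mulr_suml.
  rewrite (big_cat_nat (n := j.+1)) //= [X in _ + X]big1_seq ?addr0.
    rewrite big_mkord; apply: eq_bigr => i _.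
    by rewrite expr1n mul1r -mulr_natl mulrAC.
  by move=> i; rewrite mem_index_iota => /andP[_ /andP[ltji _]];
     rewrite bin_small // !mul0r.
apply: eq_big_nat => i /= ltin.
rewrite (big_cat_nat (n := i)) ?(ltnW ltin) //= [X in X + _]big1_seq ?add0r //.
move=> j; rewrite mem_index_iota => /andP[_ /andP[_ ltji]].
by rewrite bin_small // !mul0r.
Qed.

Lemma sum_geometric (K : fieldType) (x : K) n :
  x - 1 != 0 -> \sum_(0 <= i < n) x ^+ i = (x ^+ n - 1) / (x - 1).
Proof. by move=> x1; rewrite subrX1 big_mkord mulrAC mulfV // mul1r. Qed.

Lemma half_subr1_exp (K : fieldType) (x : K) m :
  ((x - 1) / 2) ^+ m
  = 2 ^- m * \sum_(0 <= i < m.+1) (-1) ^+ (m - i) * 'C(m, i)%:R * x ^+ i.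
Proof.
rewrite expr_div_n mulrC; congr (_ * _); rewrite addrC exprDn big_mkord.
by apply: eq_bigr => i _; rewrite -mulr_natr mulrAC.
Qed.

Theorem theorem4p1 (F : finFieldType) (p q n : nat)
    (hp : p \in [pchar F]) (hodd : odd p) (hq : #|F| = q) (hn : (1 <= n)%N) :
  [/\ (#|Gr_ge0 F 1 n|)%:R
        = \sum_(0 <= i < n) ((q%:R + 1) / 2) ^+ i :> rat,
      \sum_(0 <= i < n) ((q%:R + 1) / 2) ^+ i
        = \sum_(0 <= i < n) \sum_(i <= j < n)
            ('C(j, i)%:R / 2 ^+ j) * q%:R ^+ i :> rat
    & \sum_(0 <= i < n) \sum_(i <= j < n)
            ('C(j, i)%:R / 2 ^+ j) * q%:R ^+ i
        = (((q%:R + 1) / 2) ^+ n - 1) / ((q%:R + 1) / 2 - 1) :> rat]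
  /\
  [/\ (#|Gr_gt0 F 1 n|)%:R = ((q%:R - 1) / 2) ^+ (n - 1) :> rat
    & ((q%:R - 1) / 2) ^+ (n - 1)
        = 2 ^- (n - 1) * \sum_(0 <= i < n)
            (-1) ^+ (n - 1 - i) * 'C(n - 1, i)%:R * q%:R ^+ i :> rat].
Proof.
have two0 : (2 : F) != 0.
  rewrite -(dvdn_pcharf hp); apply: contraL hodd => p2.
  by move: p2; rewrite dvdn_prime2 ?(pcharf_prime hp) // => /eqP ->.
pose m := #|@gt0 F|.
have Dq : q = (2 * m).+1 by rewrite -hq -double_card_gt0.
have m0 : (m%:R : rat) != 0.
  rewrite pnatr_eq0 -lt0n; apply/card_gt0P; exists 1.
  by rewrite unfold_in /gt0 oner_eq0 andbT; apply/ge0P; exists 1; rewrite expr1n.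
have Dp1 : (q%:R + 1) / 2 = m.+1%:R :> rat.
  by rewrite Dq -!natr1 natrM; field.
have Dm1 : (q%:R - 1) / 2 = m%:R :> rat.
  by rewrite Dq -!natr1 natrM; field.
have Dx1 : (q%:R + 1) / 2 - 1 = m%:R :> rat by rewrite Dp1 -natr1 addrK.
have Dgeom : \sum_(0 <= i < n) ((q%:R + 1) / 2) ^+ i
    = (((q%:R + 1) / 2) ^+ n - 1) / ((q%:R + 1) / 2 - 1) :> rat.
  by rewrite sum_geometric ?Dx1.
split; split.
- rewrite Dgeom Dx1 Dp1; apply: canRL (mulfK m0) _.
  rewrite -natrM card_Gr1_ge0 card_ge0 -natrX -subn1 natrB //.
  by rewrite expn_gt0.
- exact: sum_half_powers.
- by rewrite -sum_half_powers.
- rewrite Dm1; apply: (mulIf m0).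
  by rewrite -exprSr subn1 prednK // -natrM card_Gr1_gt0 // natrX.
- by rewrite half_subr1_exp subn1 prednK.
Qed.
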